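(* Every countable submaximal space is D-separable.
   Context: A space $X$ is submaximal if every subset of $X$ is open in its closure; equivalently, if the complement of every dense set is closed and discrete. A subset is discrete if it is discrete in its subspace topology. $X$ is D-separable if for every sequence $(D_n:n\in\omega)$ of dense subspaces of $X$ one can pick discrete sets $F_n\subset D_n$ so that $\bigcup_{n\in\omega}F_n$ is dense in $X$. *)

(* Defs.v *)
From mathcomp Require Import all_boot all_classical.
From mathcomp Require Import topology.
Set Implicit Arguments.
Unset Strict Implicit.
Unset Printing Implicit Defensive.
Local Open Scope classical_set_scope.

(* [subspace A] has all of X as carrier; for B included in A, [open] at this
   type is relative openness of B in A (open_subspaceP). *)
Definition open_in (X : topologicalType) (A B : set X) : Prop :=
  B `<=` A /\ open (B : set (subspace A)).

Definition submaximal (X : topologicalType) : Prop :=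
  forall A : set X, open_in (closure A) A.

Definition discrete_set (X : topologicalType) (A : set X) : Prop :=
  forall B : set X, B `<=` A -> open_in A B.

Definition D_separable (X : topologicalType) : Prop :=
  forall D : nat -> set X, (forall n, dense (D n)) ->
  exists F : nat -> set X,
    (forall n, F n `<=` D n /\ discrete_set (F n)) /\
    dense (\bigcup_n F n).

(* Main.v *)
Require Import Defs.
From mathcomp Require Import all_boot all_classical.
From mathcomp Require Import topology.
Local Open Scope classical_set_scope.

(** In a submaximal space every set that misses a dense set is closed. Hence
    the set [G n] of the points for which [D n] is the last dense set of the
    sequence to contain them is closed discrete, since it misses [D n.+1].
    Each of the countably many points lying in infinitely many [D n] is
    assigned its own index [n]; with [P n] the set of the at most one point of
    index [n], the set [F n = P n `|` (G n `\` closure (P n))] is discrete, and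
    the closure of the union of the [F n] contains [D 0]. *)

Lemma submaximal_dense_open (X : topologicalType) (D : set X) :
  submaximal X -> dense D -> open D.
Proof.
move=> smX dD; have [_ /open_subspaceP[U oU]] := smX D.
suff -> : closure D = setT by rewrite !setIT => <-.
apply/seteqP; split=> // x _ V; rewrite nbhsE => -[W [oW Wx] WV].
have [|y [Wy Dy]] := dD W _ oW; first by exists x.
by exists y; split=> //; exact: WV.
Qed.

(** The complement of [B] contains [D], so it is dense and therefore open. *)
Lemma submaximal_codense_closed (X : topologicalType) (D B : set X) :
  submaximal X -> dense D -> B `&` D = set0 -> closed B.
Proof.
move=> smX dD BD; rewrite -openC; apply: submaximal_dense_open => // U U0 oU.
have [x [Ux Dx]] := dD U U0 oU; exists x; split=> // Bx.
by have : (B `&` D) x by []; rewrite BD.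
Qed.

(** Removing the closed part of [G] outside [B] cuts out [B] if [B] meets [P]; otherwise [closure P]
    is removed too. Points need not be closed, hence [closure P] in place of [P]. *)
Lemma discrete_set_add_point (X : topologicalType) (P G : set X) :
  is_subset1 P -> (forall B, B `<=` G -> closed B) ->
  discrete_set (P `|` (G `\` closure P)).
Proof.
move=> P1 clG B BF; split=> //; apply/open_subspaceP.
have oGB : open (~` (G `\` B)) by rewrite openC; apply: clG => x [].
have [[p [Pp Bp]]|PB0] := pselect (P `&` B !=set0).
  exists (~` (G `\` B)) => //; apply/seteqP; split=> x [xB xF].
    split=> //; case: xF => [Px|[Gx _]]; first by rewrite (P1 _ _ Px Pp).
    by apply: contrapT => nBx; apply: xB.
  by split=> // -[].
exists (~` (G `\` B) `&` ~` closure P).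
  by apply: openI => //; rewrite openC; exact: closed_closure.
apply/seteqP; split=> x.
  move=> [[xB nPx]] [Px|[Gx _]]; first by case: nPx; exact: subset_closure.
  by split; [apply: contrapT => nBx; apply: xB | right].
move=> [Bx [Px|[Gx nPx]]]; first by case: PB0; exists x.
by split; [split=> // -[] | right].
Qed.

Lemma last_index (Q : nat -> Prop) (m : nat) :
  Q 0 -> (forall n, m <= n -> ~ Q n) ->
  exists n, Q n /\ forall k, n < k -> ~ Q k.
Proof.
move=> Q0; elim: m => [/(_ 0 isT)//|m IHm Qm].
have [Qm1|nQm] := pselect (Q m); first by exists m.
apply: IHm => n; rewrite leq_eqVlt => /predU1P[<-//|]; exact: Qm.
Qed.

(** Greedy choice along an enumeration: a point in infinitely many [D n] lies in one beyond the
    index chosen at the previous stage, so the indices can strictly increase. *)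
Lemma distinct_indices (X : Type) (D : nat -> set X) :
  countable [set: X] ->
  exists f : X -> nat, injective f /\
    forall x, (forall m, exists n, m < n /\ D n x) -> D (f x) x.
Proof.
move=> /countable_injP[e /in2TT e_inj].
have /choice[g gP] : forall im : nat * nat, exists n, im.2 < n /\
    forall x, e x = im.1 -> (forall m, exists n, m < n /\ D n x) -> D n x.
  move=> [i m] /=.
  have [[x [ex /(_ m)[n [mn Dn]]]]|nx] := pselect (exists x, e x = i /\
      forall m, exists n, m < n /\ D n x).
    by exists n; split=> // y ey _; rewrite (e_inj y x) // ex.
  (* No point of code [i] lies in infinitely many [D n]: any index above [m] will do. *)
  by exists m.+1; split=> // x ex Dx; case: nx; exists x.
pose h := fix h i := g (i, if i is j.+1 then h j else 0).
have h_mono i : h i < h i.+1 by have [] := gP (i.+1, h i).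
have h_inj : injective h.
  apply: incn_inj; apply: leq_mono; exact: homo_ltn ltn_trans h_mono.
exists (h \o e); split; first exact: inj_comp.
move=> x Dx; rewrite /comp.
by case E: (e x) => [|i]; apply: (gP (_, _)).2.
Qed.

Theorem corollary69 (X : topologicalType) :
  countable [set: X] -> submaximal X -> D_separable X.
Proof.
move=> cX smX D dD.
have [f [f_inj fD]] := @distinct_indices X D cX.
pose P n := [set x | f x = n /\ D n x].
pose G n := [set x | D n x /\ forall k, n < k -> ~ D k x].
exists (fun n => P n `|` (G n `\` closure (P n))); split=> [n|].
  split; first by move=> x [[]|[[]]].
  apply: discrete_set_add_point => [x y [fx _] [fy _]|B BG].
    by apply: f_inj; rewrite fx fy.
  apply: (@submaximal_codense_closed _ (D n.+1)) => //.
  by rewrite -subset0 => x [/BG[_ /(_ n.+1 (ltnSn n))]].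
move=> U U0 oU; have [x [Ux D0x]] := dD 0 U U0 oU.
have [/fD Dfx|/existsNP[m mP]] := pselect (forall m, exists n, m < n /\ D n x).
  by exists x; split=> //; exists (f x) => //; left.
have [n Gnx] : exists n, G n x.
  apply: (@last_index (D ^~ x) m.+1) => // k mk Dk; apply: mP.
  by exists k.
(* Discarding [closure (P n)] from [G n] costs no density: if [x] is lost, [U] meets [P n]
   instead. *)
have [Px|nPx] := pselect (closure (P n) x).
  have [y [Py Uy]] := Px U (open_nbhs_nbhs (conj oU Ux)).
  by exists y; split=> //; exists n => //; left.
by exists x; split=> //; exists n => //; right.
Qed.
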